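(* For every $\alpha>0$ there exist intensities $a_1,a_2,a_3\in\mathbb{R}\setminus\{0\}$ with $\sum_{i\in P}a_i\ne0$ for every non-empty $P\subseteq\{1,2,3\}$, a time $T\in(0,+\infty)$, and an initial datum $(x_1(0),x_2(0),x_3(0))\in(\mathbb{R}^2)^3$ such that the solution of the $\alpha$-point-vortex system with $N=3$ and intensities $a_1,a_2,a_3$ is a self-similar collapse at time $T$, and such that each trajectory $x_j$ (extended to $[0,T]$ by its limit at $T$) belongs to the Hölder space $\mathcal{C}^{0,\beta}([0,T])$, $\beta\in(0,1]$, if and only if $\beta\le\frac1{\alpha+1}$. In particular the Hölder exponent $\frac{1}{\alpha+1}$ for trajectories of the $\alpha$-point-vortex system up to the time of collapse, under the hypothesis that $\sum_{i\in P}a_i\neq0$ for every non-empty set $P$ of indices, is optimal.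
   Context: For $x=(x_1,x_2)\in\mathbb{R}^2$, $x^\perp:=(-x_2,x_1)$; $\mathbb{R}^2$ is identified with $\mathbb{C}$, so that $x^\perp=\mathbf{i}x$. The $\alpha$-point-vortex system in the plane with intensities $a_1,\dots,a_N$ is $$\frac{\mathrm d}{\mathrm dt}x_i(t)=\sum_{j\neq i}a_j\,\frac{(x_i(t)-x_j(t))^\perp}{|x_i(t)-x_j(t)|^{\alpha+1}},\qquad i=1,\dots,N.$$ A solution on $[0,T)$ (with pairwise distinct $x_i(t)$) is a self-similar collapse at time $T>0$ if there exist a map $f:[0,T]\to[0,+\infty)$, continuous on $[0,T]$ and $C^1$ on $[0,T)$, and a $C^1$ map $\theta:[0,T)\to\mathbb{R}$, with $f(0)=1$, $f(T)=0$, $\theta(0)=0$, $f(t)>0$ for $t<T$, such that $x_j(t)=f(t)\,x_j(0)\,e^{\mathbf{i}\theta(t)}$ for every $j$ and every $t\in[0,T)$. *)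

(* Defs.v *)
(* Coquelicot reals and complex numbers; MathComp only for finite index sets. *)
From Stdlib Require Import Reals.
From mathcomp Require Import ssreflect ssrfun ssrbool eqtype ssrnat seq fintype finset bigop.
From Coquelicot Require Import Coquelicot.

Set Implicit Arguments.
Unset Strict Implicit.
Unset Printing Implicit Defensive.

Local Open Scope R_scope.

(* Points of R^2 are Coquelicot complex numbers, [C := R * R], with Euclidean
   norm [Cmod]. *)
Definition perp (z : C) : C := (- snd z, fst z).

Definition cis (theta : R) : C := (cos theta, sin theta).

(* Derivative of [f] at [t] relative to [D]: one-sided at an end point of an
   interval, as needed for the half-open interval [0, T). *)
Definition is_derive_within (V : NormedModule R_AbsRing) (D : R -> Prop)
    (f : R -> V) (t : R) (l : V) : Prop :=
  filterdiff f (within D (locally t)) (fun h : R => scal h l).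

Definition C1_on (D : R -> Prop) (f : R -> R) : Prop :=
  exists df : R -> R,
    (forall t, D t -> is_derive_within (V := R_NormedModule) D f t (df t)) /\
    continuous_on D df.

(* [Rpower] is only meaningful for a positive base; it is applied here to
   pairwise distinct points only. *)
Definition vortex_velocity (N : nat) (alpha : R) (a : 'I_N -> R)
    (z : 'I_N -> C) (i : 'I_N) : C :=
  \big[Cplus/RtoC 0]_(j < N | j != i)
    Cdiv (Cmult (RtoC (a j)) (perp (Cminus (z i) (z j))))
         (RtoC (Rpower (Cmod (Cminus (z i) (z j))) (alpha + 1))).

Definition is_vortex_solution (N : nat) (alpha : R) (a : 'I_N -> R) (T : R)
    (x : 'I_N -> R -> C) : Prop :=
  (forall t i j, 0 <= t < T -> i <> j -> x i t <> x j t) /\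
  (forall t i, 0 <= t < T ->
     is_derive_within (V := C_R_NormedModule) (fun s => 0 <= s < T) (x i) t
       (vortex_velocity alpha a (fun j => x j t) i)).

Definition self_similar_collapse (N : nat) (T : R) (x : 'I_N -> R -> C) : Prop :=
  exists f theta : R -> R,
    (forall t, 0 <= t <= T -> 0 <= f t) /\
    continuous_on (fun t => 0 <= t <= T) f /\
    C1_on (fun t => 0 <= t < T) f /\
    C1_on (fun t => 0 <= t < T) theta /\
    f 0 = 1 /\ f T = 0 /\ theta 0 = 0 /\
    (forall t, 0 <= t < T -> 0 < f t) /\
    (forall j t, 0 <= t < T ->
       x j t = Cmult (Cmult (RtoC (f t)) (x j 0)) (cis (theta t))).

(* liminf_{t -> T^-} |x_i(t) - x_j(t)| = 0 for some pair i <> j. *)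
Definition collapse (N : nat) (T : R) (x : 'I_N -> R -> C) : Prop :=
  exists i j : 'I_N, i <> j /\
    forall eps t0 : R, 0 < eps -> 0 <= t0 < T ->
      exists t, t0 <= t < T /\ Cmod (Cminus (x i t) (x j t)) < eps.

Definition no_null_cluster (N : nat) (a : 'I_N -> R) : Prop :=
  forall P : {set 'I_N}, P <> set0 -> \big[Rplus/0]_(i in P) a i <> 0.

Definition extends_by_limit (T : R) (y ybar : R -> C) : Prop :=
  (forall t, 0 <= t < T -> ybar t = y t) /\
  filterlim y (at_left T) (locally (ybar T : C_R_NormedModule)).

(* Membership in C^{0,beta}([0,T]): boundedness is automatic on a compact
   interval, and s <> t avoids [Rpower] at 0. *)
Definition holder (T beta : R) (y : R -> C) : Prop :=
  exists K : R, forall s t, 0 <= s <= T -> 0 <= t <= T -> s <> t ->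
    Cmod (Cminus (y s) (y t)) <= K * Rpower (Rabs (s - t)) beta.

(* [beta] is a Hölder exponent valid for all trajectories up to the time of
   collapse, for all systems without a cluster of zero total intensity. *)
Definition collapse_holder_exponent (alpha beta : R) : Prop :=
  forall (N : nat) (a : 'I_N -> R) (T : R) (x : 'I_N -> R -> C),
    no_null_cluster a -> 0 < T -> is_vortex_solution alpha a T x ->
    collapse T x ->
    forall j, exists xbar : R -> C,
      extends_by_limit T (x j) xbar /\ holder T beta xbar.

(* Main.v *)
Require Import Defs.
From Stdlib Require Import Reals Lra.
From HB Require Import structures.
From mathcomp Require Import ssreflect ssrfun ssrbool eqtype ssrnat seq fintype finset bigop.
From Coquelicot Require Import Coquelicot.

Set Implicit Arguments.
Unset Strict Implicit.

Local Open Scope R_scope.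

(** Suppose that three points z_i satisfy V_i(z) = c z_i for the vortex velocity V, with
    c = -A + iB and A > 0.  The velocity is equivariant under rotations and homogeneous
    of degree -alpha under dilations ([vortex_velocity_similar]), so z_i lambda(t) is a
    solution as soon as lambda' = c lambda |lambda|^(-alpha-1).  With lambda = f e^(i theta)
    this reads f' = -A f^(-alpha), theta' = B f^(-alpha-1), and is solved by
    f = (1 - t/T)^g, theta = -B T ln(1 - t/T), where g = 1/(alpha+1) and
    T = 1/((alpha+1) A) ([spiral_solution], [spiral_self_similar]).

    Trajectories are thus logarithmic spirals.  Although theta is unbounded, they are as
    regular as their radius f: for s < t one has
    f(t) |theta(s) - theta(t)| <= C (f(s) - f(t)), from 1 + x <= e^x, and
    f(s) - f(t) <= ((t - s)/T)^g by subadditivity of the power g <= 1.  Hence they are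
    g-Hölder ([holder_spiral]).  Comparing with the end point, |x_j(t) - x_j(T)| is
    exactly |z_j| (1 - t/T)^g, so a larger exponent fails when z_j is nonzero
    ([holder_spiral_sharp]).

    It remains to find a configuration z with nonzero z_i and intensities without null
    cluster.  Write L_k for the squared length of the side opposite to vertex k and w_k for
    L_k^(-(alpha+1)/2).  Conservation of the moment of inertia and of the energy forces
    the sums of L_k / a_k and of L_k w_k / a_k to vanish, so a triangle determines the
    1/a_k up to a factor.  For L = (1, 2, 4) and q = 2^(-(alpha+1)/2) one has
    w = (1, q, q^2), whence a = (1+q, -2q, 4q(1+q)): everything becomes rational in q
    and the square root of 7, all cluster sums are visibly nonzero for 0 < q < 1, and the
    relation V = c z is a polynomial identity ([vertex_central]).  One orientation of the
    triangle expands, the other one collapses.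

    This one example also refutes every exponent above g as a uniform one, because
    extensions by a limit are unique. *)

(** * Hölder regularity of logarithmic spirals *)

Lemma Cmod_cis (a : R) : Cmod (cis a) = 1.
Proof.
rewrite /Cmod /cis /= !Rmult_1_r.
have -> : cos a * cos a + sin a * sin a = 1.
  by have := sin2_cos2 a; rewrite /Rsqr; lra.
exact: sqrt_1.
Qed.

(** A chord is shorter than its arc; the chord has length 2 |sin ((a - b) / 2)|. *)
Lemma Cmod_cis_sub (a b : R) : Cmod (Cminus (cis a) (cis b)) <= Rabs (a - b).
Proof.
rewrite /Cmod /cis /=.
have E : (cos a + - cos b) * ((cos a + - cos b) * 1)
       + (sin a + - sin b) * ((sin a + - sin b) * 1) = (2 * sin ((a - b) / 2)) ^ 2.
  have h := cos_2a_sin ((a - b) / 2).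
  have -> : (2 * sin ((a - b) / 2)) ^ 2 = 2 - 2 * cos (a - b).
    have -> : a - b = 2 * ((a - b) / 2) by field.
    rewrite h; have -> : 2 * ((a - b) / 2) / 2 = (a - b) / 2 by field.
    ring.
  rewrite cos_minus.
  have := sin2_cos2 a; have := sin2_cos2 b; rewrite /Rsqr; nra.
rewrite E -Rsqr_pow2 sqrt_Rsqr_abs Rabs_mult (Rabs_pos_eq 2); last lra.
have H : forall u, Rabs (sin u) <= Rabs u.
  have pos : forall u, 0 < u -> Rabs (sin u) <= u.
    move=> u u0; apply: Rabs_le; split; last by left; exact: sin_lt_x.
    case: (Rlt_dec u PI) => [h|h].
      have := sin_ge_0 u; lra.
    have := SIN_bound u; have := PI2_1; lra.
  move=> u; case: (Rtotal_order u 0) => [h|[->|h]].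
  - by rewrite (Rabs_left u) // -Rabs_Ropp -sin_neg; apply: pos; lra.
  - by rewrite sin_0; lra.
  - by rewrite (Rabs_pos_eq u); [apply: pos | lra].
have := H ((a - b) / 2).
have -> : Rabs (a - b) = 2 * Rabs ((a - b) / 2).
  rewrite /Rdiv Rabs_mult (Rabs_pos_eq (/ 2)); lra.
lra.
Qed.

Lemma polar_increment (r s a b : R) : 0 <= s ->
  Cmod (Cminus (Cmult (RtoC r) (cis a)) (Cmult (RtoC s) (cis b)))
    <= Rabs (r - s) + s * Rabs (a - b).
Proof.
move=> s0.
have -> : Cminus (Cmult (RtoC r) (cis a)) (Cmult (RtoC s) (cis b))
   = Cplus (Cmult (RtoC (r - s)) (cis a)) (Cmult (RtoC s) (Cminus (cis a) (cis b))).
  by rewrite RtoC_minus; ring.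
apply: Rle_trans (Cmod_triangle _ _) _.
rewrite !Cmod_mult !Cmod_R Cmod_cis (Rabs_pos_eq s) // Rmult_1_r.
apply: Rplus_le_compat_l; apply: Rmult_le_compat_l => //; exact: Cmod_cis_sub.
Qed.

Lemma Rpower_gt0 (x y : R) : 0 < Rpower x y.
Proof. exact: exp_pos. Qed.

Lemma Rpower_base1 (y : R) : Rpower 1 y = 1.
Proof. by rewrite /Rpower ln_1 Rmult_0_r exp_0. Qed.

(** Each of the fractions x = a / (a + b) and x = b / (a + b) is at most x ^ g, because
    x <= 1 and g <= 1; the two fractions add up to 1. *)
Lemma Rpower_subadditive (g a b : R) : 0 < g <= 1 -> 0 < a -> 0 < b ->
  Rpower (a + b) g <= Rpower a g + Rpower b g.
Proof.
move=> g01 a0 b0.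
have frac x : 0 < x < a + b -> x / (a + b) * Rpower (a + b) g <= Rpower x g.
  move: g01 => [g0 g1] [hx0 hx1].
  have {2}-> : x = x / (a + b) * (a + b) by field; lra.
  have x0 : 0 < x / (a + b) by apply: Rdiv_lt_0_compat; lra.
  rewrite -Rpower_mult_distr; try lra.
  apply: Rmult_le_compat_r; first by left; exact: Rpower_gt0.
  have x1 : x / (a + b) < 1.
    apply: (Rmult_lt_reg_r (a + b)); first lra.
    by have -> : x / (a + b) * (a + b) = x by [field; lra]; lra.
  have {1}-> : x / (a + b) = exp (ln (x / (a + b))) by rewrite exp_ln.
  rewrite /Rpower.
  have l0 : ln (x / (a + b)) < 0 by rewrite -ln_1; exact: ln_increasing.
  have : ln (x / (a + b)) <= g * ln (x / (a + b)) by nra.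
  case=> [h|<-]; last lra.
  by left; apply: exp_increasing.
have ha := frac a ltac:(lra); have hb := frac b ltac:(lra).
have : a / (a + b) * Rpower (a + b) g + b / (a + b) * Rpower (a + b) g = Rpower (a + b) g.
  by field; lra.
lra.
Qed.

(** The value 0 from time T on is imposed because [Rpower] equals 1, not 0, at a zero
    base. *)
Definition radius (g T t : R) : R :=
  if Rlt_dec t T then Rpower (1 - t / T) g else 0.

Definition angle (d T t : R) : R := d * ln (1 - t / T).

Definition spiral (g d T : R) (z : C) (t : R) : C :=
  Cmult (Cmult (RtoC (radius g T t)) z) (cis (angle d T t)).

Lemma radius_lt (g T t : R) : t < T -> radius g T t = Rpower (1 - t / T) g.
Proof. by rewrite /radius; case: Rlt_dec. Qed.

Lemma radius_end (g T : R) : radius g T T = 0.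
Proof. by rewrite /radius; case: Rlt_dec => h /=; lra. Qed.

Lemma radius_ge0 (g T t : R) : 0 <= radius g T t.
Proof.
rewrite /radius; case: Rlt_dec => h /=; last lra.
by left; exact: Rpower_gt0.
Qed.

Lemma remaining_time_gt0 (T t : R) : 0 < T -> t < T -> 0 < 1 - t / T.
Proof.
move=> T0 h; have -> : 1 - t / T = (T - t) / T by field; lra.
by apply: Rdiv_lt_0_compat; lra.
Qed.

Lemma Cmod_spiral (g d T : R) (z : C) (t : R) :
  Cmod (spiral g d T z t) = radius g T t * Cmod z.
Proof.
by rewrite /spiral !Cmod_mult Cmod_R Cmod_cis Rabs_pos_eq ?Rmult_1_r //; exact: radius_ge0.
Qed.

Lemma radius_increment (g T s t : R) : 0 < g <= 1 -> 0 < T -> s < t <= T ->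
  0 <= radius g T s - radius g T t <= Rpower (/ T) g * Rpower (t - s) g.
Proof.
move=> g01 T0 [st tT].
have iT : 0 < / T by apply: Rinv_0_lt_compat.
rewrite Rpower_mult_distr //; last lra.
rewrite radius_lt; last lra.
have s0 := remaining_time_gt0 T0 (Rlt_le_trans _ _ _ st tT).
case: (Rle_lt_or_eq_dec _ _ tT) => [h|->]; last first.
  rewrite radius_end Rminus_0_r; split; first by left; exact: Rpower_gt0.
  have -> : / T * (T - s) = 1 - s / T by field; lra.
  lra.
rewrite radius_lt //; have t0 := remaining_time_gt0 T0 h.
have d0 : 0 < / T * (t - s) by apply: Rmult_lt_0_compat; lra.
have E : 1 - s / T = / T * (t - s) + (1 - t / T) by field; lra.
split; last by have := Rpower_subadditive g01 d0 t0; rewrite -E; lra.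
have : Rpower (1 - t / T) g <= Rpower (1 - s / T) g.
  apply: Rle_Rpower_l; lra.
lra.
Qed.

(** The angle winds infinitely often near T, but slowly compared with the shrinking
    radius: with v / u the ratio of the remaining times, the increment of the angle is
    (d / g) ln ((v / u) ^ g), and ln y <= y - 1. *)
Lemma radius_angle_increment (g d T s t : R) : 0 < g -> 0 < T -> s < t <= T ->
  radius g T t * Rabs (angle d T s - angle d T t)
    <= Rabs d / g * (radius g T s - radius g T t).
Proof.
move=> g0 T0 [st tT].
have dg : 0 <= Rabs d / g.
  by apply: Rmult_le_pos; [exact: Rabs_pos | left; exact: Rinv_0_lt_compat].
case: (Rle_lt_or_eq_dec _ _ tT) => [h|->]; last first.
  rewrite radius_end Rmult_0_l Rminus_0_r.
  by apply: Rmult_le_pos => //; exact: radius_ge0.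
rewrite !radius_lt //; last lra.
have t0 := remaining_time_gt0 T0 h.
have ht : 1 - t / T < 1 - s / T.
  have -> : 1 - s / T = 1 - t / T + (t - s) / T by field; lra.
  have : 0 < (t - s) / T by apply: Rdiv_lt_0_compat; lra.
  lra.

rewrite /angle -Rmult_minus_distr_l Rabs_mult.
set u := 1 - t / T in t0 ht *; set v := 1 - s / T in ht *.
have l0 : ln u < ln v by exact: ln_increasing.
rewrite (Rabs_pos_eq (ln v - ln u)); last lra.
have E : Rpower v g = Rpower u g * exp (g * (ln v - ln u)).
  by rewrite /Rpower -exp_plus; congr exp; ring.
have key : g * (ln v - ln u) * Rpower u g <= Rpower v g - Rpower u g.
  have := exp_ineq1_le (g * (ln v - ln u)); have := Rpower_gt0 u g; rewrite E; nra.
have -> : Rpower u g * (Rabs d * (ln v - ln u))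
          = Rabs d / g * (g * (ln v - ln u) * Rpower u g) by field; lra.
exact: Rmult_le_compat_l.
Qed.

Lemma holder_of_ordered (T b K : R) (y : R -> C) :
  (forall s t, 0 <= s -> s < t <= T ->
     Cmod (Cminus (y s) (y t)) <= K * Rpower (t - s) b) ->
  holder T b y.
Proof.
move=> H; exists K => s t hs ht st.
case: (Rdichotomy _ _ st) => h.
  by rewrite Rabs_left ?Ropp_minus_distr; [apply: H | ]; lra.
rewrite Rabs_pos_eq; last lra.
have -> : Cminus (y s) (y t) = Copp (Cminus (y t) (y s)) by ring.
by rewrite Cmod_opp; apply: H; lra.
Qed.

Lemma holder_spiral (g d T : R) (z : C) : 0 < g <= 1 -> 0 < T ->
  holder T g (spiral g d T z).
Proof.
move=> g01 T0.
apply: (@holder_of_ordered T g (Cmod z * ((1 + Rabs d / g) * Rpower (/ T) g))) => s t s0 st.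
have -> : Cminus (spiral g d T z s) (spiral g d T z t) = Cmult z
    (Cminus (Cmult (RtoC (radius g T s)) (cis (angle d T s)))
            (Cmult (RtoC (radius g T t)) (cis (angle d T t)))).
  by rewrite /spiral; ring.
rewrite Cmod_mult !Rmult_assoc; apply: Rmult_le_compat_l; first exact: Cmod_ge_0.
have [r1 r2] := @radius_increment g T s t g01 T0 st.
apply: Rle_trans (polar_increment _ _ _ (radius_ge0 g T t)) _.
rewrite Rabs_pos_eq //.
have [g0 _] := g01.
have := @radius_angle_increment g d T s t g0 T0 st.
have : 0 <= 1 + Rabs d / g.
  have : 0 <= Rabs d / g by apply: Rmult_le_pos; [exact: Rabs_pos | left; exact: Rinv_0_lt_compat].
  lra.
nra.
Qed.

Lemma holder_weaken (T g b : R) (y : R -> C) : b <= g -> holder T g y -> holder T b y.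
Proof.
move=> bg [K HK].
exists (Rabs K * Rpower T (g - b)) => s t hs ht st.
apply: Rle_trans (HK s t hs ht st) _.
have st0 : 0 < Rabs (s - t) by apply: Rabs_pos_lt; lra.
have stT : Rabs (s - t) <= T by apply: Rabs_le; lra.
have {1}-> : g = (g - b) + b by ring.
rewrite Rpower_plus Rmult_assoc.
have h1 : Rpower (Rabs (s - t)) (g - b) <= Rpower T (g - b) by apply: Rle_Rpower_l; lra.
have h2 := Rpower_gt0 (Rabs (s - t)) (g - b); have h3 := Rpower_gt0 (Rabs (s - t)) b.
have := Rle_abs K; have := Rabs_pos K => K0 K1.
apply: Rle_trans (_ : _ <= Rabs K * (Rpower (Rabs (s - t)) (g - b) * Rpower (Rabs (s - t)) b)) _.
  by apply: Rmult_le_compat_r => //; apply: Rmult_le_pos; lra.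
apply: Rmult_le_compat_l => //.
by apply: Rmult_le_compat_r; lra.
Qed.

(** The distance to the end point is |z| (1 - t / T) ^ g.  If it were bounded by a multiple
    of (T - t) ^ b with b > g, then |z| <= L u ^ (b - g) for every remaining fraction
    u of the time, which is absurd for small u. *)
Lemma holder_spiral_sharp (g d T b : R) (z : C) : 0 < T -> z <> RtoC 0 ->
  holder T b (spiral g d T z) -> b <= g.
Proof.
move=> T0 z0 [K HK]; case: (Rle_lt_dec b g) => // gb.
have Z : 0 < Cmod z by apply/Cmod_gt_0.
pose L := Rabs K * Rpower T b.
have L0 : 0 <= L.
  by apply: Rmult_le_pos; [exact: Rabs_pos | left; exact: Rpower_gt0].
(* e is the value wanted for u ^ (b - g): it makes L * e < Cmod z, and is below 1. *)
pose e := Cmod z / (2 * (L + Cmod z)).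
have e0 : 0 < e by apply: Rdiv_lt_0_compat; lra.
have eE : e * (2 * (L + Cmod z)) = Cmod z by rewrite /e; field; lra.
have e1 : e < 1 by nra.
pose u := Rpower e (/ (b - g)).
have u0 : 0 < u by exact: Rpower_gt0.
have ubg : Rpower u (b - g) = e.
  by rewrite /u Rpower_mult Rinv_l ?Rpower_1 //; lra.
have u1 : u < 1.
  rewrite /u /Rpower -exp_0; apply: exp_increasing.
  have : ln e < 0 by rewrite -ln_1; exact: ln_increasing.
  have : 0 < / (b - g) by apply: Rinv_0_lt_compat; lra.
  nra.
have sT : T - T * u < T by nra.
have := HK (T - T * u) T ltac:(nra) ltac:(lra) ltac:(lra).
have -> : spiral g d T z T = RtoC 0 by rewrite /spiral radius_end; ring.
have -> : Cminus (spiral g d T z (T - T * u)) (RtoC 0) = spiral g d T z (T - T * u) by ring.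
rewrite Cmod_spiral radius_lt //.
have -> : 1 - (T - T * u) / T = u by field; lra.
rewrite Rabs_left; last lra.
have -> : - (T - T * u - T) = T * u by ring.
rewrite -Rpower_mult_distr //.
have -> : Rpower u b = Rpower u g * e by rewrite -ubg -Rpower_plus; congr Rpower; ring.
have ug := Rpower_gt0 u g.
move=> H.
have H2 : Rpower u g * Cmod z <= Rpower u g * (L * e).
  apply: Rle_trans H _.
  have -> : K * (Rpower T b * (Rpower u g * e)) = K * (Rpower T b * Rpower u g * e) by ring.
  have -> : Rpower u g * (L * e) = Rabs K * (Rpower T b * Rpower u g * e) by rewrite /L; ring.
  apply: Rmult_le_compat_r; last exact: Rle_abs.
  by apply: Rmult_le_pos; [left; apply: Rmult_lt_0_compat => //; exact: Rpower_gt0 | lra].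
have H3 := Rmult_le_reg_l _ _ _ ug H2.
nra.
Qed.

(** The codomain carries the product topology of R * R, whence the passage from [Cmod] to
    the two coordinates. *)
Lemma holder_cvg (T b : R) (y : R -> C) (t : R) : 0 < b -> holder T b y -> 0 <= t <= T ->
  filterlim y (within (fun s => 0 <= s <= T) (locally t))
    (locally (y t : C_R_NormedModule)).
Proof.
move=> b0 [K HK] ht.
apply/filterlim_locally => eps.
have K1 : 0 < Rabs K + 1 by have := Rabs_pos K; lra.
have e0 : 0 < eps / (Rabs K + 1) by apply: Rdiv_lt_0_compat => //; exact: cond_pos.
exists (mkposreal _ (Rpower_gt0 (eps / (Rabs K + 1)) (/ b))) => s /= hst hs.
have H : Cmod (Cminus (y s) (y t)) < eps.
  case: (Req_dec s t) => [->|st].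
    have -> : Cminus (y t) (y t) = RtoC 0 by ring.
    by rewrite Cmod_0; exact: cond_pos.
  apply: Rle_lt_trans (HK s t hs ht st) _.
  have st0 : 0 < Rabs (s - t) by apply: Rabs_pos_lt; lra.
  have h : Rpower (Rabs (s - t)) b < eps / (Rabs K + 1).
    have -> : eps / (Rabs K + 1) = Rpower (Rpower (eps / (Rabs K + 1)) (/ b)) b.
      by rewrite Rpower_mult Rinv_l ?Rpower_1 //; lra.
    by apply: Rlt_Rpower_l.
  have E : eps / (Rabs K + 1) * (Rabs K + 1) = eps by field; lra.
  have := Rle_abs K; have := Rabs_pos K; have := Rpower_gt0 (Rabs (s - t)) b; nra.
have [M1 M2] : Rabs (fst (Cminus (y s) (y t))) <= Cmod (Cminus (y s) (y t)) /\
   Rabs (snd (Cminus (y s) (y t))) <= Cmod (Cminus (y s) (y t)).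
  have := Rmax_Cmod (Cminus (y s) (y t)); split; apply: Rle_trans H0.
    exact: Rmax_l.
  exact: Rmax_r.
split; [exact: Rle_lt_trans M1 H | exact: Rle_lt_trans M2 H].
Qed.

Lemma holder_extends (T b : R) (y : R -> C) : 0 < b -> 0 < T -> holder T b y ->
  extends_by_limit T y y.
Proof.
move=> b0 T0 H; split=> //.
have hT : 0 <= T <= T by lra.
apply: filterlim_filter_le_1 (holder_cvg b0 H hT).
move=> P [e He].
exists (mkposreal _ (Rmin_pos e T (cond_pos e) T0)) => s hs sT.
have [] := Rmin_Rgt_l e T (Rabs (s - T)).
  by move: hs; rewrite /ball /= /AbsRing_ball /abs /= /minus /plus /opp /=.
move=> h1 h2; apply: He => //.
have : Rabs (s - T) < T by [].
by move/Rabs_def2; lra.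
Qed.

(** * The motion issued from a central configuration *)

Lemma is_derive_within_of_is_derive (V : NormedModule R_AbsRing) (D : R -> Prop)
    (f : R -> V) (t : R) (l : V) :
  D t -> is_derive f t l -> is_derive_within D f t l.
Proof.
move=> Dt H.
apply: (@filterdiff_locally _ _ _ _ _ _ t) => //.
- split; last exact: within_filter.
  by move=> P HP; exists t; exact: (locally_singleton t _ HP).
- by move=> P HP; apply: filter_imp HP => s Ps _.
Qed.

Lemma C1_on_of_is_derive (D : R -> Prop) (f df : R -> R) :
  (forall t, D t -> is_derive f t (df t)) ->
  (forall t, D t -> continuous df t) -> C1_on D f.
Proof.
move=> H C; exists df; split; last exact: continuous_on_forall.
by move=> t Dt; apply: is_derive_within_of_is_derive => //; exact: H.
Qed.

Lemma near_lt (t T : R) : t < T -> locally t (fun s => s < T).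
Proof. exact: open_lt. Qed.

Lemma is_derive_radius (g T t : R) : 0 < T -> t < T ->
  is_derive (radius g T) t (- (g / T) * Rpower (1 - t / T) (g - 1)).
Proof.
move=> T0 tT; have u0 := remaining_time_gt0 T0 tT.
apply: (is_derive_ext_loc (fun s => Rpower (1 - s / T) g)).
  by apply: filter_imp (near_lt tT) => s sT; rewrite radius_lt.
rewrite /Rpower; auto_derive; first by [].
change (1 + - (t * / T)) with (1 - t / T); set u := 1 - t / T in u0 *.
have -> : (g - 1) * ln u = g * ln u + - ln u by ring.
by rewrite exp_plus exp_Ropp exp_ln //; field; lra.
Qed.

Lemma is_derive_angle (d T t : R) : 0 < T -> t < T ->
  is_derive (angle d T) t (- (d / T) / (1 - t / T)).
Proof.
move=> T0 tT; have u0 := remaining_time_gt0 T0 tT.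
rewrite /angle; auto_derive; first by [].
by field; lra.
Qed.

(** Linearity reduces the derivative of a planar curve to that of scalar multiples of
    the two basis vectors. *)
Lemma is_derive_C (u v : R -> R) (t lu lv : R) :
  is_derive u t lu -> is_derive v t lv ->
  is_derive (fun s => (u s, v s) : C_R_NormedModule) t (lu, lv).
Proof.
move=> Hu Hv.
have H := is_derive_plus _ _ _ _ _
  (is_derive_scal_l u t lu ((1, 0) : C_R_NormedModule) Hu)
  (is_derive_scal_l v t lv ((0, 1) : C_R_NormedModule) Hv).
have -> : (lu, lv) = plus (scal lu ((1, 0) : C_R_NormedModule)) (scal lv ((0, 1) : C_R_NormedModule)).
  by congr pair; rewrite /= /scal /= /mult /plus /=; ring.
apply: is_derive_ext H => s.
by congr pair; rewrite /= /scal /= /mult /plus /=; ring.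
Qed.

Lemma is_derive_polar (r theta : R -> R) (z : C) (t dr dtheta : R) :
  is_derive r t dr -> is_derive theta t dtheta ->
  is_derive (fun s => Cmult (Cmult (RtoC (r s)) z) (cis (theta s)) : C_R_NormedModule) t
    (Cmult (Cmult (dr, r t * dtheta) z) (cis (theta t))).
Proof.
move=> Hr Hth.
have Dr := is_derive_unique _ _ _ Hr; have Dth := is_derive_unique _ _ _ Hth.
have Er : ex_derive r t by exists dr.
have Eth : ex_derive theta t by exists dtheta.
apply: (is_derive_ext (fun s => (r s * (fst z * cos (theta s) - snd z * sin (theta s)),
   r s * (fst z * sin (theta s) + snd z * cos (theta s))) : C_R_NormedModule)).
  by move=> s; congr pair; rewrite /=; ring.
have -> : Cmult (Cmult (dr, r t * dtheta) z) (cis (theta t)) =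
  (dr * (fst z * cos (theta t) - snd z * sin (theta t))
     + r t * (fst z * - (dtheta * sin (theta t)) - snd z * (dtheta * cos (theta t))),
   dr * (fst z * sin (theta t) + snd z * cos (theta t))
     + r t * (fst z * (dtheta * cos (theta t)) + snd z * - (dtheta * sin (theta t)))).
  by congr pair; rewrite /=; ring.
by apply: is_derive_C; auto_derive => //; rewrite ?Dr ?Dth; ring.
Qed.

(** Rotations commute with the quarter turn and preserve distances; a dilation by r
    multiplies each numerator by r and each denominator by r ^ (alpha + 1). *)
Lemma vortex_velocity_similar (N : nat) (alpha : R) (a : 'I_N -> R) (z : 'I_N -> C)
    (r theta : R) (i : 'I_N) :
  0 < r -> (forall i j, i <> j -> z i <> z j) ->
  vortex_velocity alpha a (fun j => Cmult (Cmult (RtoC r) (z j)) (cis theta)) i =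
  Cmult (Cmult (RtoC (Rpower r (- alpha))) (cis theta)) (vortex_velocity alpha a z i).
Proof.
move=> r0 zinj; rewrite /vortex_velocity.
rewrite (big_morph (Cmult (Cmult (RtoC (Rpower r (- alpha))) (cis theta)))
  (id1 := RtoC 0) (op1 := Cplus)); last by ring.
  2: by move=> u v; ring.
apply: eq_bigr => j /eqP ji.
have -> : Cminus (Cmult (Cmult (RtoC r) (z i)) (cis theta)) (Cmult (Cmult (RtoC r) (z j)) (cis theta))
   = Cmult (Cmult (RtoC r) (Cminus (z i) (z j))) (cis theta) by ring.
have w0 : 0 < Cmod (Cminus (z i) (z j)).
  apply/Cmod_gt_0 => h; apply: (zinj i j); first by move=> e; apply: ji.
  have -> : z i = Cplus (Cminus (z i) (z j)) (z j) by ring.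
  by rewrite h; ring.
move: (Cminus (z i) (z j)) w0 => w w0.
rewrite !Cmod_mult Cmod_cis Rmult_1_r Cmod_R Rabs_pos_eq; last lra.
rewrite -Rpower_mult_distr // RtoC_mult.
have -> : perp (Cmult (Cmult (RtoC r) w) (cis theta)) = Cmult (Cmult (RtoC r) (perp w)) (cis theta).
  by congr pair; rewrite /=; ring.
have W : RtoC (Rpower (Cmod w) (alpha + 1)) <> RtoC 0.
  by move=> /RtoC_inj; have := Rpower_gt0 (Cmod w) (alpha + 1); lra.
have Ra : Rpower r (- alpha) * Rpower r (alpha + 1) = r.
  by rewrite -Rpower_plus -Rplus_assoc Rplus_opp_l Rplus_0_l Rpower_1.
have P : RtoC (Rpower r (alpha + 1)) <> RtoC 0.
  by move=> /RtoC_inj; have := Rpower_gt0 r (alpha + 1); lra.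
rewrite -{1}Ra RtoC_mult.
by field.
Qed.

Section CentralConfiguration.

Variables (N : nat) (alpha A B : R) (a : 'I_N -> R) (z : 'I_N -> C).
Hypotheses (alpha_gt0 : 0 < alpha) (A_gt0 : 0 < A).
Hypothesis z_inj : forall i j, i <> j -> z i <> z j.
Hypothesis central : forall i, vortex_velocity alpha a z i = Cmult (- A, B) (z i).

(* The equation f' = - A f ^ (- alpha) with f(0) = 1 makes f ^ (alpha + 1) affine of
   slope - (alpha + 1) A: this gives the exponent g and the time T. *)
Let g := 1 / (alpha + 1).
Let T := / ((alpha + 1) * A).
Let x i := spiral g (- B * T) T (z i).

Lemma collapse_time_gt0 : 0 < T.
Proof. by apply: Rinv_0_lt_compat; nra. Qed.

Lemma spiral_solution : is_vortex_solution alpha a T x.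
Proof.
have T0 := collapse_time_gt0.
split=> [t i j [t0 tT] ij|t i [t0 tT]].
  rewrite /x /spiral => h; apply: (z_inj ij).
  have : Cmult (Cmult (RtoC (radius g T t)) (cis (angle (- B * T) T t))) (Cminus (z i) (z j)) = RtoC 0.
    rewrite (_ : Cmult _ _ = Cminus (Cmult (Cmult (RtoC (radius g T t)) (z i)) (cis (angle (- B * T) T t))) (Cmult (Cmult (RtoC (radius g T t)) (z j)) (cis (angle (- B * T) T t)))); last by ring.
    by rewrite h; ring.
  move/(f_equal Cmod); rewrite !Cmod_mult Cmod_cis Cmod_R Cmod_0 Rmult_1_r => h2.
  have e : Cminus (z i) (z j) = RtoC 0.
    apply: Cmod_eq_0; move: h2; rewrite Rabs_pos_eq; last exact: radius_ge0.
    rewrite radius_lt //; have := Rpower_gt0 (1 - t / T) g.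
    by move=> p /Rmult_integral []; lra.
  have -> : z i = Cplus (Cminus (z i) (z j)) (z j) by ring.
  by rewrite e; ring.
apply: is_derive_within_of_is_derive => //.
have u0 := remaining_time_gt0 T0 tT.
have r0 : 0 < radius g T t by rewrite radius_lt //; exact: Rpower_gt0.
rewrite /x /spiral (vortex_velocity_similar alpha a _ i r0 z_inj) central.
have := is_derive_polar (z i) (is_derive_radius g T0 tT) (is_derive_angle (- B * T) T0 tT).
congr is_derive.
(* Both derivatives are expressed through f ^ (- alpha) = (1 - t / T) ^ (g - 1). *)
have Ag : g / T = A by rewrite /g /T; field; lra.
have E : Rpower (radius g T t) (- alpha) = Rpower (1 - t / T) (g - 1).
  by rewrite radius_lt // Rpower_mult; congr Rpower; rewrite /g; field; lra.
rewrite E.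
have -> : radius g T t = Rpower (1 - t / T) (g - 1) * (1 - t / T).
  by rewrite radius_lt // -{3}(Rpower_1 (1 - t / T) u0) -Rpower_plus; congr Rpower; ring.
rewrite Ag.
have -> : Rpower (1 - t / T) (g - 1) * (1 - t / T) * (- (- B * T / T) / (1 - t / T))
  = B * Rpower (1 - t / T) (g - 1).
  by field; split; lra.
by congr pair; rewrite /=; ring.
Qed.

Lemma exponent_bounds : 0 < g <= 1.
Proof.
have g0 : 0 < g by apply: Rdiv_lt_0_compat; lra.
have : g * (alpha + 1) = 1 by rewrite /g; field; lra.
nra.
Qed.

Lemma spiral_start (w : C) : spiral g (- B * T) T w 0 = w.
Proof.
have T0 := collapse_time_gt0.
rewrite /spiral /angle radius_lt // /Rdiv Rmult_0_l Rminus_0_r Rpower_base1 ln_1 Rmult_0_r /cis.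
by rewrite cos_0 sin_0; apply: injective_projections => /=; ring.
Qed.

Lemma spiral_self_similar : self_similar_collapse T x.
Proof.
have T0 := collapse_time_gt0; have g01 := exponent_bounds.
exists (radius g T), (angle (- B * T) T).
split; first by move=> t _; exact: radius_ge0.
split.
  (* The radius is the spiral without rotation issued from 1, so its continuity at T
     follows from the Hölder bound. *)
  move=> t ht.
  have H := holder_cvg (proj1 g01) (holder_spiral 0 (RtoC 1) g01 T0) ht.
  have E s : spiral g 0 T (RtoC 1) s = RtoC (radius g T s).
    by rewrite /spiral /angle Rmult_0_l /cis cos_0 sin_0; apply: injective_projections => /=; ring.
  move: H; rewrite E.
  move/filterlim_locally => H; apply/filterlim_locally => eps.
  by apply: filter_imp (H eps) => s; rewrite E => -[].
split.
  apply: C1_on_of_is_derive => [t [t0 tT]|t [t0 tT]]; first exact: is_derive_radius.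
  apply: ex_derive_continuous; have := remaining_time_gt0 T0 tT.
  by rewrite /Rpower /Rdiv => u0; auto_derive.
split.
  apply: C1_on_of_is_derive => [t [t0 tT]|t [t0 tT]]; first exact: is_derive_angle.
  apply: ex_derive_continuous; have := remaining_time_gt0 T0 tT.
  by rewrite /Rdiv => u0; auto_derive; lra.
split; first by rewrite radius_lt // /Rdiv Rmult_0_l Rminus_0_r Rpower_base1.
split; first exact: radius_end.
split; first by rewrite /angle /Rdiv Rmult_0_l Rminus_0_r ln_1 Rmult_0_r.
split; first by move=> t [t0 tT]; rewrite radius_lt //; exact: Rpower_gt0.
by move=> j t _; rewrite /x spiral_start.
Qed.

End CentralConfiguration.

(** * A collapsing triangle *)

HB.instance Definition _ :=
  Monoid.isComLaw.Build C (RtoC 0) Cplus Cplus_assoc Cplus_comm Cplus_0_l.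

HB.instance Definition _ :=
  Monoid.isComLaw.Build R 0 Rplus (fun x y z => esym (Rplus_assoc x y z)) Rplus_comm Rplus_0_l.

Definition triple (T : Type) (u v w : T) (i : 'I_3) : T := nth w [:: u; v] i.

Lemma ord3_case (P : 'I_3 -> Prop) :
  P ord0 -> P (lift ord0 ord0) -> P (lift ord0 (lift ord0 ord0)) -> forall i, P i.
Proof.
move=> P0 P1 P2 [m hm].
case: m hm => [|[|[|//]]] hm.
- by rewrite (_ : Ordinal hm = ord0) //; exact: val_inj.
- by rewrite (_ : Ordinal hm = lift ord0 ord0) //; exact: val_inj.
- by rewrite (_ : Ordinal hm = lift ord0 (lift ord0 ord0)) //; exact: val_inj.
Qed.

Lemma triple_no_null_cluster (a b c : R) :
  a <> 0 -> b <> 0 -> c <> 0 -> a + b <> 0 -> a + c <> 0 -> b + c <> 0 ->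
  a + b + c <> 0 -> no_null_cluster (triple a b c).
Proof.
move=> a0 b0 c0 ab ac bc abc P P0.
rewrite big_mkcond /= !big_ord_recl big_ord0 /triple /=.
case: ifP => h0; case: ifP => h1; case: ifP => h2; try lra.
case: P0; apply/setP; rewrite /eq_mem; apply: ord3_case; by rewrite inE.
Qed.

Lemma triple_injective (u v w : C) :
  u <> v -> v <> w -> u <> w -> forall i j, i <> j -> triple u v w i <> triple u v w j.
Proof.
move=> uv vw uw; apply: ord3_case; apply: ord3_case; rewrite /triple //= => _;
  by move=> e; subst.
Qed.

Lemma vortex_velocity_triple (alpha a b c : R) (u v w : C) :
  let pull m s r := Cdiv (Cmult (RtoC m) (perp (Cminus s r)))
     (RtoC (Rpower (Cmod (Cminus s r)) (alpha + 1))) in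
  let V := vortex_velocity alpha (triple a b c) (triple u v w) in
  V ord0 = Cplus (pull b u v) (pull c u w) /\
  V (lift ord0 ord0) = Cplus (pull a v u) (pull c v w) /\
  V (lift ord0 (lift ord0 ord0)) = Cplus (pull a w u) (pull b w v).
Proof.
rewrite /vortex_velocity.
split; last split; rewrite big_mkcond /= !big_ord_recl big_ord0 /triple /=; ring.
Qed.

(** The height of the triangle with squared sides 1, 2 and 4 over its side of length 1. *)
Definition half_root7 : R := sqrt 7 / 2.

Lemma half_root7_sq : half_root7 * half_root7 = 7 / 4.
Proof. have := sqrt_sqrt 7 ltac:(lra); rewrite /half_root7; lra. Qed.

Lemma half_root7_gt0 : 0 < half_root7.
Proof. have := sqrt_lt_R0 7 ltac:(lra); rewrite /half_root7; lra. Qed.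

Section CollapsingTriangle.

Variable q : R.
Hypothesis q01 : 0 < q < 1.

Definition total_intensity : R := 1 + 3 * q + 4 * q ^ 2.

(** The unique choice, up to a factor, for which both the moment of inertia and the energy
    vanish: the sums of L_k / a_k and of L_k w_k / a_k are zero for L = (1, 2, 4) and
    w = (1, q, q ^ 2). *)
Definition intensity : 'I_3 -> R := triple (1 + q) (- 2 * q) (4 * q * (1 + q)).

(** The triangle is placed with its centre of vorticity at the origin, as V = c z with
    c nonzero requires since the weighted velocities add up to zero.  The side vectors are
    z2 - z3 = (1, 0), z3 - z1 = (1/2, -h) and z1 - z2 = (-3/2, h), with h = [half_root7];
    the mirror image, with -h in place of h, would expand. *)
Definition vertex1 : C :=
  ((q - 2 * q ^ 2) / total_intensity, half_root7 * (2 * q + 4 * q ^ 2) / total_intensity).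
Definition vertex2 : C :=
  ((1 + q) * (4 * q + 3 / 2) / total_intensity, - half_root7 * (1 + q) / total_intensity).
Definition vertex3 : C :=
  (((1 + q) / 2 + 2 * q) / total_intensity, - half_root7 * (1 + q) / total_intensity).

Definition vertex : 'I_3 -> C := triple vertex1 vertex2 vertex3.

Lemma total_intensity_gt0 : 0 < total_intensity.
Proof. rewrite /total_intensity; nra. Qed.

Lemma side12 : Cminus vertex1 vertex2 = (- 3 / 2, half_root7).
Proof.
have := total_intensity_gt0 => S0.
by congr pair; rewrite /= /total_intensity; field; move: S0; rewrite /total_intensity; lra.
Qed.

Lemma side23 : Cminus vertex2 vertex3 = (1, 0).
Proof.
have := total_intensity_gt0 => S0.
by congr pair; rewrite /= /total_intensity; field; move: S0; rewrite /total_intensity; lra.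
Qed.

Lemma side31 : Cminus vertex3 vertex1 = (1 / 2, - half_root7).
Proof.
have := total_intensity_gt0 => S0.
by congr pair; rewrite /= /total_intensity; field; move: S0; rewrite /total_intensity; lra.
Qed.

Lemma vertex_neq0 i : vertex i <> RtoC 0.
Proof.
have S0 := total_intensity_gt0; have h0 := half_root7_gt0.
have nz y : y <> 0 -> y / total_intensity <> 0.
  by move=> y0 /Rmult_integral []; [ | apply: Rinv_neq_0_compat; lra].
move: i; apply: ord3_case; rewrite /vertex /triple /= => -[_ /nz]; apply; nra.
Qed.

Lemma vertex_injective i j : i <> j -> vertex i <> vertex j.
Proof.
apply: triple_injective => e.
- by have := side12; rewrite e => -[h _]; lra.
- by have := side23; rewrite e => -[h _]; lra.
- by have := side31; rewrite e => -[h _]; lra.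
Qed.

(** Only the second intensity is negative; its sums with the others are 1 - q,
    2 q + 4 q ^ 2 and [total_intensity], all positive. *)
Lemma intensity_no_null_cluster : no_null_cluster intensity.
Proof. by apply: triple_no_null_cluster; nra. Qed.

Lemma intensity_neq0 i : intensity i <> 0.
Proof. by move: i; apply: ord3_case; rewrite /intensity /triple /=; nra. Qed.

(** Real part (up to sign) and imaginary part of c = i (S - a_1 W), where
    W = (z2 - z3) + q (z3 - z1) + q ^ 2 (z1 - z2) and S is the total intensity; this
    expression of c comes from V_2 - V_3 = c (z2 - z3). *)
Definition contraction_rate : R := half_root7 * q * (1 - q ^ 2).
Definition rotation_rate : R := q / 2 * (3 + q) * (1 + 3 * q).

Lemma contraction_rate_gt0 : 0 < contraction_rate.
Proof.
rewrite /contraction_rate; apply: Rmult_lt_0_compat; last nra.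
by apply: Rmult_lt_0_compat; [exact: half_root7_gt0 | lra].
Qed.

(** For this value of q the weights |z_i - z_j| ^ (- alpha - 1) are 1, q and q ^ 2, so that
    alpha disappears and only a rational identity in q and the square root of 7 is left. *)
Lemma vertex_central (alpha : R) : q = Rpower 2 (- ((alpha + 1) / 2)) ->
  forall i, vortex_velocity alpha intensity vertex i
            = Cmult (- contraction_rate, rotation_rate) (vertex i).
Proof.
move=> qE.
have w1 : Rpower 1 (alpha + 1) = 1 by exact: Rpower_base1.
have w2 : Rpower (sqrt 2) (alpha + 1) = / q.
  rewrite -(Rpower_sqrt 2); last lra.
  by rewrite qE Rpower_mult -Rpower_Ropp; congr Rpower; field.
have w3 : Rpower 2 (alpha + 1) = / q ^ 2.
  rewrite qE -Rpower_pow; last exact: Rpower_gt0.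
  by rewrite Rpower_mult -Rpower_Ropp; congr Rpower; rewrite /=; field.
have hh := half_root7_sq.
have norm (w : C) (s : R) : 0 <= s -> fst w * fst w + snd w * snd w = s * s -> Cmod w = s.
  by move=> s0 e; rewrite /Cmod /= !Rmult_1_r e sqrt_square.
have r7 := sqrt_sqrt 7 ltac:(lra).
have r2 := sqrt_sqrt 2 ltac:(lra); have r20 := sqrt_pos 2.
have E12 := side12; have E23 := side23; have E31 := side31.
have E21 : Cminus vertex2 vertex1 = (3 / 2, - half_root7).
  rewrite (_ : Cminus _ _ = Copp (Cminus vertex1 vertex2)); last by ring.
  by rewrite E12; congr pair; rewrite /=; field.
have E32 : Cminus vertex3 vertex2 = (-1, 0).
  rewrite (_ : Cminus _ _ = Copp (Cminus vertex2 vertex3)); last by ring.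
  by rewrite E23; congr pair; rewrite /=; ring.
have E13 : Cminus vertex1 vertex3 = (- 1 / 2, half_root7).
  rewrite (_ : Cminus _ _ = Copp (Cminus vertex3 vertex1)); last by ring.
  by rewrite E31; congr pair; rewrite /=; field.
have [V1 [V2 V3]] := vortex_velocity_triple alpha (1 + q) (- 2 * q) (4 * q * (1 + q)) vertex1 vertex2 vertex3.
have S0 := total_intensity_gt0.
have norm2 (w : C) : fst w * fst w + snd w * snd w = 4 -> Rpower (Cmod w) (alpha + 1) = / q ^ 2.
  by move=> e; rewrite (norm w 2) //; lra.
have norms (w : C) : fst w * fst w + snd w * snd w = 2 -> Rpower (Cmod w) (alpha + 1) = / q.
  by move=> e; rewrite (norm w (sqrt 2)) // r2.
have norm1 (w : C) : fst w * fst w + snd w * snd w = 1 -> Rpower (Cmod w) (alpha + 1) = / 1.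
  by move=> e; rewrite (norm w 1) ?w1 ?Rinv_1 //; lra.
have pull m k (p : C) : k <> 0 ->
    Cdiv (Cmult (RtoC m) p) (RtoC (/ k)) = (m * fst p * k, m * snd p * k).
  move=> k0; have ik := Rinv_neq_0_compat _ k0; rewrite /Cdiv -RtoC_inv // Rinv_inv.
  by apply: injective_projections => /=; ring.
have S1 : 1 + 3 * q + 4 * q ^ 2 <> 0 by move: S0; rewrite /total_intensity; lra.
apply: ord3_case; rewrite /intensity /vertex ?V1 ?V2 ?V3.
- rewrite E12 E13 norm2 ?norms /=; try lra.
  rewrite !pull; try nra.
  rewrite /vertex1 /contraction_rate /rotation_rate /total_intensity /half_root7.
  by congr pair; rewrite /=; field [r7]; rewrite ?Rmult_1_r; nra.
- rewrite E21 E23 norm2 ?norm1 /=; try lra.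
  rewrite !pull; try nra.
  rewrite /vertex2 /contraction_rate /rotation_rate /total_intensity /half_root7.
  by congr pair; rewrite /=; field [r7]; rewrite ?Rmult_1_r; nra.
- rewrite E31 E32 norms ?norm1 /=; try lra.
  rewrite !pull; try nra.
  rewrite /vertex3 /contraction_rate /rotation_rate /total_intensity /half_root7.
  by congr pair; rewrite /=; field [r7]; rewrite ?Rmult_1_r; nra.
Qed.

End CollapsingTriangle.

(** * Optimality of the exponent *)

Lemma filterlim_at_left_unique (T : R) (y : R -> C) (u v : C) :
  filterlim y (at_left T) (locally (u : C_R_NormedModule)) ->
  filterlim y (at_left T) (locally (v : C_R_NormedModule)) -> u = v.
Proof.
move=> hu hv.
exact (@filterlim_locally_unique R R_AbsRing C_R_NormedModule (at_left T)
  (Proper_StrongProper _ (at_left_proper_filter T)) y u v hu hv).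
Qed.

Lemma holder_extension_unique (T b : R) (y ybar ybar' : R -> C) :
  extends_by_limit T y ybar -> extends_by_limit T y ybar' ->
  holder T b ybar -> holder T b ybar'.
Proof.
move=> [e l] [e' l'] [K HK]; exists K.
have E t : 0 <= t <= T -> ybar' t = ybar t.
  move=> [t0 tT]; case: (Rle_lt_or_eq_dec _ _ tT) => [h|->].
    by rewrite e ?e'.
  exact: filterlim_at_left_unique l' l.
by move=> s t hs ht st; rewrite !E //; exact: HK.
Qed.

Lemma collapsing_triple (alpha : R) : 0 < alpha ->
  exists (a : 'I_3 -> R) (T : R) (x : 'I_3 -> R -> C),
     (forall i, a i <> 0) /\ no_null_cluster a /\ 0 < T /\
     is_vortex_solution alpha a T x /\
     self_similar_collapse T x /\
     (forall j, extends_by_limit T (x j) (x j)) /\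
     (forall j beta, 0 < beta <= 1 -> (holder T beta (x j) <-> beta <= 1 / (alpha + 1))).
Proof.
move=> alpha0.
pose q := Rpower 2 (- ((alpha + 1) / 2)).
have q01 : 0 < q < 1.
  split; first exact: Rpower_gt0.
  rewrite -(Rpower_O 2); last lra.
  by apply: Rpower_lt; lra.
have A0 := contraction_rate_gt0 q01.
have inj := vertex_injective q01.
have central := vertex_central q01 (erefl q).
have T0 := collapse_time_gt0 alpha0 A0.
have g01 := exponent_bounds alpha0.
exists (intensity q), (/ ((alpha + 1) * contraction_rate q)).
eexists.
split; first exact: intensity_neq0.
split; first exact: intensity_no_null_cluster.
split; first exact: T0.
split; first exact: (spiral_solution alpha0 A0 inj central).
split; first exact: (spiral_self_similar _ (vertex q) alpha0 A0).
have H j := holder_spiral (- rotation_rate q * / ((alpha + 1) * contraction_rate q)) (vertex q j) g01 T0.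
split=> [j|j beta [b0 b1]]; first exact: holder_extends (proj1 g01) T0 (H j).
split=> [|bg]; last exact: holder_weaken bg (H j).
by apply: holder_spiral_sharp => //; exact: vertex_neq0.
Qed.

Lemma self_similar_collapse_collapse (N : nat) (T : R) (x : 'I_N -> R -> C) (i j : 'I_N) :
  i <> j -> 0 < T -> self_similar_collapse T x -> collapse T x.
Proof.
move=> ij T0 [f [theta [fp [fc [_ [_ [_ [fT [_ [fp' xE]]]]]]]]]].
exists i, j; split=> // eps t0 eps0 ht0.
pose L := Cmod (Cminus (x i 0) (x j 0)).
have L0 : 0 <= L := Cmod_ge_0 _.
have e0 : 0 < eps / (L + 1) by apply: Rdiv_lt_0_compat; lra.
have := fc T ltac:(lra); rewrite fT => /filterlim_locally /(_ (mkposreal _ e0)) [d Hd].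
have d0 := cond_pos d.
pose t := Rmax t0 (T - d / 2).
have t1 : t0 <= t := Rmax_l _ _.
have t2 : T - d / 2 <= t := Rmax_r _ _.
have t3 : t < T by apply: Rmax_lub_lt; lra.
exists t; split=> //.
have ft : f t < eps / (L + 1).
  have : Rabs (f t - 0) < eps / (L + 1).
    apply: (Hd t) => /=; last lra.
    have : Rabs (t - T) < d by apply: Rabs_def1; lra.
    by [].
  by move/Rabs_def2; lra.
have ht : 0 <= t < T by lra.
rewrite (xE i t ht) (xE j t ht).
have -> : Cminus (Cmult (Cmult (RtoC (f t)) (x i 0)) (cis (theta t)))
                 (Cmult (Cmult (RtoC (f t)) (x j 0)) (cis (theta t)))
        = Cmult (Cmult (RtoC (f t)) (Cminus (x i 0) (x j 0))) (cis (theta t)) by ring.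
rewrite !Cmod_mult Cmod_cis Cmod_R Rmult_1_r Rabs_pos_eq; last by left; exact: fp'.
rewrite -/L.
have E : eps / (L + 1) * (L + 1) = eps by field; lra.
have := fp' t ht; nra.
Qed.

Theorem mainTheorem4 :
  forall alpha : R, 0 < alpha ->
  (exists (a : 'I_3 -> R) (T : R) (x0 : 'I_3 -> C) (x xbar : 'I_3 -> R -> C),
     (forall i, a i <> 0) /\
     no_null_cluster a /\
     0 < T /\
     (forall j, x j 0 = x0 j) /\
     is_vortex_solution alpha a T x /\
     self_similar_collapse T x /\
     (forall j, extends_by_limit T (x j) (xbar j)) /\
     (forall j beta, 0 < beta <= 1 ->
        (holder T beta (xbar j) <-> beta <= 1 / (alpha + 1)))) /\
  (forall beta, 1 / (alpha + 1) < beta <= 1 ->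
     ~ collapse_holder_exponent alpha beta).
Proof.
move=> alpha alpha0.
have [a [T [x [a0 [cl [T0 [sol [ss [ext hol]]]]]]]]] := collapsing_triple alpha0.
split; first by exists a, T, (fun j => x j 0), x, x; do !split=> //; apply hol.
move=> beta [b1 b2] H.
have coll : collapse T x.
  exact: (@self_similar_collapse_collapse _ _ _ ord0 (lift ord0 ord0)).
have [xbar [ext' hol']] := H 3%N a T x cl T0 sol coll ord0.
have b0 : 0 < beta.
  by apply: Rlt_trans b1; apply: Rdiv_lt_0_compat; lra.
have := proj1 (hol ord0 beta (conj b0 b2)) (holder_extension_unique ext' (ext ord0) hol').
lra.
Qed.
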